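(* Let $G=C_m\wr S_n$, where $C_m=\{1,w,w^2,\dots,w^{m-1}\}$ is cyclic of order $m$ with generator $w$, and let $H$ be a subgroup of $G$ conjugate to $K_0=\{[w^j,w^j,\dots,w^j;\sigma]\mid\sigma\in S_n,\ j=0,1,\dots,m-1\}$. For $j=0,1,\dots,m-1$, let $X_{w^j}$ be the conjugacy class of $G$ corresponding to the $m$-color partition $({}_{w^j}n)$. Let $\gcd(m,n)=d$ and $m=dt$. Then, for every $l\in\{1,2,\dots,t\}$ and every subset $I\subseteq C_m$ of size $dl$ obtained by taking exactly $l$ elements from each coset of $\langle w^d\rangle$ in $C_m$, $$r\cdot G=H\cdot\bigcup_{i\in I}X_i,\qquad\text{where } r=dl\,(n-1)!.$$
   Context: $C_m\wr S_n=C_m^n\rtimes S_n$ (the generalized symmetric group) consists of the elements $[a_1,\dots,a_n;\sigma]$ with $a_i\in C_m$, $\sigma\in S_n$, with multiplication $$[a_1,\dots,a_n;\sigma]\cdot[b_1,\dots,b_n;\tau]=[a_1b_{\sigma(1)},\dots,a_nb_{\sigma(n)};\sigma\tau],$$ where products in $S_n$ are taken from left to right, i.e. $(\sigma\tau)(i)=\tau(\sigma(i))$. Conjugacy classes of $C_m\wr S_n$ are indexed by $m$-color partitions of $n$: each cycle $(k_1,\dots,k_s)$ of $\sigma$ contributes a part ${}_{w^j}s$, where $w^j=\prod_i a_{k_i}$ is its cycle product. In particular, the class $X_{w^j}$ corresponding to $({}_{w^j}n)$ is the set of all $[b_1,\dots,b_n;\tau]$ with $\tau$ an $n$-cycle and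 $\prod_i b_i=w^j$. For a finite group $G$, subsets $A,B\subseteq G$ and a positive integer $r$, the notation $r\cdot G=A\cdot B$ means that for every $g\in G$ there are exactly $r$ pairs $(a,b)\in A\times B$ with $ab=g$. *)

(* Defs.v *)
From HB Require Import structures.
From mathcomp Require Import all_boot all_fingroup.

Set Implicit Arguments.
Unset Strict Implicit.
Unset Printing Implicit Defensive.

Local Open Scope group_scope.

(* C wr S_n, elements [a_1, ..., a_n; s], for a finite group C. *)
Record wreath (cT : finGroupType) (n : nat) := Wreath {
  wcol : {ffun 'I_n -> cT};
  wperm : 'S_n
}.

Section WreathGroup.

Variables (cT : finGroupType) (n : nat).
Implicit Types x y z : wreath cT n.

Definition wreath_pair x := (wcol x, wperm x).
Definition pair_wreath (p : {ffun 'I_n -> cT} * 'S_n) := Wreath p.1 p.2.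

Lemma wreath_pairK : cancel wreath_pair pair_wreath.
Proof. by case. Qed.

HB.instance Definition _ := Finite.copy (wreath cT n) (can_type wreath_pairK).

(* The product of permutations in 'S_n is already read from left to right:
   (s * t) i = t (s i), see permM. *)
Definition wreath_mul x y : wreath cT n :=
  Wreath [ffun i => wcol x i * wcol y (wperm x i)] (wperm x * wperm y).
Definition wreath_one : wreath cT n := Wreath [ffun=> 1] 1.
Definition wreath_inv x : wreath cT n :=
  Wreath [ffun i => (wcol x ((wperm x)^-1 i))^-1] (wperm x)^-1.

Lemma wreath_mulA : associative wreath_mul.
Proof.
move=> x y z; rewrite /wreath_mul /= mulgA; congr Wreath.
by apply/ffunP=> i; rewrite !ffunE permM mulgA.
Qed.

Lemma wreath_mul1 : left_id wreath_one wreath_mul.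
Proof.
case=> a s; rewrite /wreath_mul /= mul1g; congr Wreath.
by apply/ffunP=> i; rewrite !ffunE perm1 mul1g.
Qed.

Lemma wreath_mulV : left_inverse wreath_one wreath_inv wreath_mul.
Proof.
case=> a s; rewrite /wreath_mul /wreath_one /= mulVg; congr Wreath.
by apply/ffunP=> i; rewrite !ffunE mulVg.
Qed.

HB.instance Definition _ :=
  Finite_isGroup.Build (wreath cT n) wreath_mulA wreath_mul1 wreath_mulV.

End WreathGroup.

Section ColorClasses.

Variables (cT : finGroupType) (n : nat).
Implicit Types (x : wreath cT n) (c : {set 'I_n}) (z : cT).

(* Only meaningful for abelian color groups, where the order of the factors is
   irrelevant. *)
Definition cycle_product x c : cT := \prod_(i in c) wcol x i.

(* A colored partition is a list of pairs (color, size), up to permutation;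
   fixed points of wperm x are cycles of length 1. *)
Definition color_type x : seq (cT * nat) :=
  [seq (cycle_product x c, #|c|) | c <- enum (porbits (wperm x))].

(* The class of the colored partition with the single part n, of color z. *)
Definition color_class z : {set wreath cT n} :=
  [set x | perm_eq (color_type x) [:: (z, n)]].

Lemma color_classP z x : 0 < n ->
  reflect (porbits (wperm x) = [set [set: 'I_n]] /\ \prod_i wcol x i = z)
          (x \in color_class z).
Proof.
move=> n_gt0; rewrite inE; apply: (iffP idP) => [xz|[px <-]]; last first.
  rewrite /color_type px enum_set1 /= cardsT card_ord /cycle_product.
  have -> : \prod_(i in [set: 'I_n]) wcol x i = \prod_i wcol x i.
    by apply: eq_bigl => i; rewrite inE.
  exact: perm_refl.
have sz : #|porbits (wperm x)| = 1%N.
  by have := perm_size xz; rewrite size_map -cardE.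
have [c pc] := cards1P (introT eqP sz).
move: xz; rewrite /color_type pc enum_set1 /= => /perm_mem/(_ (z, n)).
rewrite !inE eqxx => /eqP[zE nE].
have cT' : c = [set: 'I_n].
  by apply/eqP; rewrite eqEcard subsetT cardsT card_ord -nE leqnn.
rewrite zE cT'; split=> //; rewrite /cycle_product.
by apply: eq_bigl => i; rewrite inE.
Qed.

(* The colored permutations [w^j, ..., w^j; s]. *)
Definition diag_sym (w : cT) : {set wreath cT n} :=
  [set Wreath [ffun=> w ^+ (j : 'I_#[w])] s | j : 'I_#[w], s : 'S_n].

Lemma mem_diag_sym (w : cT) k (s : 'S_n) :
  Wreath [ffun=> w ^+ k] s \in diag_sym w.
Proof.
have kw : k %% #[w] < #[w] by rewrite ltn_mod order_gt0.
apply/imset2P; exists (Ordinal kw) s => //=.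
by rewrite expg_mod_order.
Qed.

Lemma diag_sym_group_set w : group_set (diag_sym w).
Proof.
apply/group_setP; split=> [|_ _ /imset2P[j s _ _ ->] /imset2P[k t _ _ ->]].
  exact: (mem_diag_sym w 0 1).
have -> : Wreath [ffun=> w ^+ j] s * Wreath [ffun=> w ^+ k] t
        = Wreath [ffun=> w ^+ (j + k)] (s * t) :> wreath cT n.
  by congr Wreath; apply/ffunP=> i; rewrite !ffunE expgD.
exact: mem_diag_sym.
Qed.

Canonical diag_sym_group w := Group (diag_sym_group_set w).

End ColorClasses.

Arguments color_class {cT} n z.
Arguments diag_sym {cT} n w.

(* r . G = A . B, for G the full group gT. *)
Definition rfold_factorization (gT : finGroupType) (r : nat)
    (A B : {set gT}) : Prop :=
  forall g : gT, #|[set p in setX A B | p.1 * p.2 == g]| = r.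

(* Main.v *)
From HB Require Import structures.
Require Import Defs.
From mathcomp Require Import all_boot all_fingroup cyclic.

(** Counting pairs (h, x) with [h * x = g] amounts to counting the h in H with
[h^-1 * g] in the union X of the color classes ([card_factorizations]). As X
is closed under conjugation, H may be replaced by the standard copy K of
[C_m * S_n] while g is conjugated accordingly ([card_factorizationsJ]).

In K the condition splits. Write [h = [c, ..., c; s]] and [g = [a; sigma]], and
let A be the product of the entries of a. Over an abelian color group the
product of all colors is a homomorphism ([wreath_prodM]), so [h^-1 * g] lies
in X exactly when [s^-1 sigma] is an n-cycle and [c^-n A] lies in I
([card_diag_sym_translate]).
- The first condition leaves (n-1)! choices of s, one for each n-cycle. The
  n-cycles form one conjugacy class, namely that of the rotation
  [i |-> i + 1], whose centralizer has order n ([card_full_cycle]).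
- The second condition does not depend on s. The map [c |-> c^n] is a
  gcd(m, n)-to-one homomorphism of the cyclic group [<w>] onto
  [<w^n> = <w^d>], so [c^-n A] covers the coset of A modulo [<w^d>], each of
  its elements d times ([card_expg_translate]). This coset meets I in l
  elements, which gives dl choices of c. *)

Set Implicit Arguments.
Unset Strict Implicit.
Unset Printing Implicit Defensive.

Local Open Scope group_scope.

(** * Permutations with a single cycle *)

Definition full_cycle n (s : 'S_n) := porbits s == [set [set: 'I_n]].

Lemma full_cycleP n (s : 'S_n.+1) :
  reflect (forall x y, y \in porbit s x) (full_cycle s).
Proof.
apply: (iffP eqP) => [sT x y | sT].
  by have := imset_f (porbit s) (isT : x \in 'I_n.+1); rewrite -/(porbits s) sT
    inE => /eqP->; rewrite inE.
have sx x : porbit s x = [set: 'I_n.+1] by apply/setP=> y; rewrite sT inE.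
apply/setP=> c; rewrite inE; apply/imsetP/eqP=> [[x _ ->] // | ->].
by exists ord0; rewrite ?sx.
Qed.

Definition rotation n : 'S_n.+1 := perm (@ordS_inj n.+1).

Lemma rotationE n (i : 'I_n.+1) : rotation n i = i.+1 %% n.+1 :> nat.
Proof. by rewrite permE. Qed.

(** This makes the rotation a convenient reference: its powers reach every point
from 0 in a prescribed number of steps. *)
Lemma rotationX0 n (i : 'I_n.+1) : (rotation n ^+ i) ord0 = i.
Proof.
apply: val_inj; rewrite permX /=; case: i => i /=.
elim: i => [|i IH] lt_in //=; rewrite rotationE IH ?(ltnW lt_in) //.
by rewrite modn_small.
Qed.

Lemma full_cycle_rotation n : full_cycle (rotation n).
Proof.
apply/full_cycleP=> x y; rewrite -(rotationX0 x) porbit_perm.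
by rewrite -(rotationX0 y) mem_porbit.
Qed.

Lemma full_cycleJ n (s p : 'S_n.+1) : full_cycle s -> full_cycle (s ^ p).
Proof.
move/full_cycleP=> sT; apply/full_cycleP=> x y.
have /porbitP[i iE] := sT (p^-1 x) (p^-1 y).
by apply/porbitP; exists i; rewrite -conjXg -(permKV p x) permJ -iE permKV.
Qed.

(** A permutation t with a single cycle lists all points as 0, t 0, t (t 0), ...,
and relabelling i as the i-th point of this list turns the rotation into t. *)
Lemma full_cycle_class n :
  [set s : 'S_n.+1 | full_cycle s] = rotation n ^: [set: 'S_n.+1].
Proof.
apply/setP=> t; rewrite inE; apply/idP/imsetP=> [t_full | [p _ ->]]; last first.
  exact: full_cycleJ (full_cycle_rotation n).
have tT : porbit t ord0 = [set: 'I_n.+1].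
  by apply/setP=> y; rewrite inE (full_cycleP t t_full).
have t0 : #|porbit t ord0| = n.+1 by rewrite tT cardsT card_ord.
pose f (i : 'I_n.+1) := iter i t ord0.
have f_inj : injective f.
  (* The list f 0, ..., f n is the orbit of 0, hence has no repetition. *)
  move=> i j fij; apply: val_inj => /=; apply/eqP.
  rewrite -(nth_uniq ord0 _ _ (uniq_traject_porbit t ord0)) ?size_traject ?t0 //.
  by rewrite !nth_traject ?t0 //; apply/eqP.
exists (perm f_inj) => //; apply/permP=> y.
rewrite -(permKV (perm f_inj) y); move: (_ y) => {y} i.
rewrite permJ !permE {2}/f /f -iterS; case: i => i /= lt_in.
(* Only the last index wraps around, where the orbit of 0 closes up. *)
move: lt_in; rewrite ltnS leq_eqVlt => /predU1P[->|lt_in].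
  by rewrite modnn /=; have := iter_porbit t ord0; rewrite t0.
by rewrite modn_small.
Qed.

(** A permutation that commutes with the rotation is determined by its value
at 0, and the powers of the rotation realize every value. *)
Lemma card_cent_rotation n : #|'C[rotation n]| = n.+1.
Proof.
have cE (c : 'S_n.+1) i : c \in 'C[rotation n] ->
    c i = (rotation n ^+ i) (c ord0).
  move=> /cent1P/(commuteX i) cz.
  by rewrite -{1}(rotationX0 i) -!permM cz.
rewrite -[RHS]card_ord -(card_in_imset (f := fun c : 'S_n.+1 => c ord0)).
  rewrite -cardsT; apply: eq_card => i; rewrite inE; apply/imsetP.
  exists (rotation n ^+ i); last by rewrite rotationX0.
  by apply/cent1P; apply: commute_sym; apply: commuteX.
by move=> b c zb zc bc; apply/permP=> i; rewrite (cE b) // (cE c) // bc.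
Qed.

Lemma card_full_cycle n : #|[set s : 'S_n.+1 | full_cycle s]| = n`!.
Proof.
apply/eqP; rewrite -(eqn_pmul2l (ltn0Sn n)) -factS -card_Sn -cardsT.
rewrite full_cycle_class -index_cent1 setTI -{1}(card_cent_rotation n).
by rewrite Lagrange ?subsetT.
Qed.

(** * Powers and products in a cyclic color group *)

(** A cyclic group has only one subgroup of each order. *)
Lemma cycle_gcd (gT : finGroupType) (x : gT) n :
  <[x ^+ n]> = <[x ^+ gcdn #[x] n]>.
Proof.
apply/eqP; rewrite (eq_subG_cyclic (cycle_cyclic x)) ?cycleX //.
by rewrite -!orderE !orderXgcd gcdnA gcdnn.
Qed.

Section CyclicColors.
Variables (cT : finGroupType) (w : cT).
Hypothesis w_gen : [set: cT] = <[w]>.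

Lemma color_mulC : commutative (@mulg cT).
Proof.
have: abelian [set: cT] by rewrite w_gen cycle_abelian.
by move=> /centsP cT_abel x y; apply: cT_abel; rewrite inE.
Qed.

(** The n-th power map is an endomorphism of the cyclic group, with image
[<[w ^+ n]>] of order [#[w] %/ gcdn #[w] n]. Its fibers over the image are the
cosets of its kernel, which therefore has order [gcdn #[w] n]. *)
Lemma card_expg_preim n (B : {set cT}) : B \subset <[w ^+ n]> ->
  #|[set c | c ^+ n \in B]| = (gcdn #[w] n * #|B|)%N.
Proof.
move=> sB.
pose f := [morphism of cyclem n w].
have inw x : x \in <[w]> by rewrite -w_gen inE.
have imf : f @* <[w]> = <[w ^+ n]> by rewrite morphim_cycle.
have cardK : #|'ker f| = gcdn #[w] n.
  have := card_morphim f <[w]>; rewrite imf setIid -orderE orderXgcd => ko.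
  have q_gt0 : 0 < #[w] %/ gcdn #[w] n.
    by rewrite divn_gt0 ?gcdn_gt0 ?order_gt0 // dvdn_leq ?dvdn_gcdl.
  apply/eqP; rewrite -(eqn_pmul2r q_gt0) {1}ko Lagrange ?subsetIl // -orderE.
  by rewrite mulnC divnK ?dvdn_gcdl.
rewrite -sum1_card (partition_big (fun c : cT => c ^+ n) [in B]) /=; last first.
  by move=> c; rewrite inE.
rewrite -cardK mulnC -sum_nat_const; apply: eq_bigr => y By.
have /imsetP[c0 _ yE] : y \in [set c ^+ n | c in [set: cT]].
  have := subsetP sB y By; rewrite -imf => /morphimP[c _ _ ->].
  by apply/imsetP; exists c.
rewrite sum1_card -(card_rcoset ('ker f) c0); apply: eq_card => c.
rewrite unfold_in /= inE; have /= P := rcoset_kerP f (inw c) (inw c0).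
apply/andP/P => [[_ /eqP cy] | fc]; first by rewrite /cyclem cy yE.
by rewrite [c ^+ n]fc [cyclem n w c0]/= /cyclem -yE By.
Qed.

(** As c varies, [(c ^+ n)^-1 * a] runs through the coset [a *: <[w ^+ n]>] and
takes each value equally often. *)
Lemma card_expg_translate n (I : {set cT}) a :
  #|[set c : cT | (c ^+ n)^-1 * a \in I]|
    = (gcdn #[w] n * #|I :&: a *: <[w ^+ n]>|)%N.
Proof.
pose f (y : cT) := y^-1 * a.
have f_inj : injective f by move=> y y' /mulIg/invg_inj.
pose B := f @^-1: (I :&: a *: <[w ^+ n]>).
have fB y : (f y \in a *: <[w ^+ n]>) = (y \in <[w ^+ n]>).
  by rewrite mem_lcoset /f color_mulC mulgK groupV.
rewrite -(card_preimset (I :&: _) f_inj) -/B -card_expg_preim.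
  apply: eq_card => c; rewrite [LHS]inE [RHS]inE [RHS]inE in_setI fB.
  have /cycleP[k ->] : c \in <[w]> by rewrite -w_gen inE.
  by rewrite -expgM mulnC expgM mem_cycle andbT.
by apply/subsetP=> y; rewrite inE in_setI fB => /andP[].
Qed.

(** * Color classes and the diagonal subgroup *)

(** The permutation part of x only reorders the colors of y, so for abelian colors
the product of all colors is multiplicative. *)
Lemma wreath_prodM n :
  {morph (fun x : wreath cT n => \prod_i wcol x i) : x y / x * y}.
Proof.
(* Reordering a big product needs a commutative law; cT has one by w_gen only. *)
pose L : Monoid.com_law 1 := HB.pack (@mulg cT)
  (Monoid.isComLaw.Build cT 1 mulg (@mulgA _) color_mulC (@mul1g _)).
move=> x y /=.
rewrite (eq_bigr (fun i => wcol x i * wcol y (wperm x i))); last first.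
  by move=> i _; rewrite ffunE.
have -> : \prod_i wcol y i = \prod_i wcol y (wperm x i).
  exact: (@reindex_inj _ L 1 _ (wperm x) xpredT (wcol y) (@perm_inj _ _)).
exact: (big_split L).
Qed.

Lemma wreath_prodV n (x : wreath cT n) :
  \prod_i wcol x^-1 i = (\prod_i wcol x i)^-1.
Proof.
apply: (mulIg (\prod_i wcol x i)); rewrite -wreath_prodM !mulVg.
by rewrite big1 // => i _; rewrite ffunE.
Qed.

Lemma mem_color_classU n (I : {set cT}) (x : wreath cT n.+1) :
  (x \in \bigcup_(z in I) color_class n.+1 z)
    = full_cycle (wperm x) && (\prod_i wcol x i \in I).
Proof.
apply/bigcupP/andP=> [[z Iz /(color_classP _ _ (ltn0Sn n))[px zE]] | [x_full Ix]].
  by rewrite /full_cycle px eqxx zE.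
by exists (\prod_i wcol x i) => //; apply/color_classP=> //; rewrite (eqP x_full).
Qed.

Lemma color_classU_conj n (I : {set cT}) (x g : wreath cT n.+1) :
  x \in \bigcup_(z in I) color_class n.+1 z ->
  x ^ g \in \bigcup_(z in I) color_class n.+1 z.
Proof.
rewrite !mem_color_classU => /andP[x_full Ix]; apply/andP; split.
  exact: full_cycleJ.
by rewrite !wreath_prodM wreath_prodV [X in _ * X]color_mulC mulKg.
Qed.

(** Since w generates the colors, the constant color of an element of [diag_sym]
is arbitrary and need not be recorded as an exponent of w. *)
Lemma diag_symE n : diag_sym n w =
  [set Wreath [ffun=> p.1] p.2 | p in [set: cT * 'S_n]].
Proof.
apply/setP=> h; apply/imset2P/imsetP=> [[j s _ _ ->] | [[c s] _ ->]].
  by exists (w ^+ j, s).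
have /cycleP[k ->] : c \in <[w]> by rewrite -w_gen inE.
by apply/imset2P; apply: mem_diag_sym.
Qed.

(** For h with constant color c and permutation s, [h^-1 * g] has permutation
[s^-1 * wperm g] and color product [(c ^+ n.+1)^-1] times that of g. The
conditions on s and on c are thus independent, and translation by [wperm g]
matches the admissible s with the full cycles. *)
Lemma card_diag_sym_translate n (I : {set cT}) (g : wreath cT n.+1) :
  #|[set h in diag_sym n.+1 w |
      h^-1 * g \in \bigcup_(z in I) color_class n.+1 z]|
    = (#|[set c : cT | ((c ^+ n.+1)^-1 * \prod_i wcol g i)%g \in I]| * n`!)%N.
Proof.
pose e (p : cT * 'S_n.+1) : wreath cT n.+1 := Wreath [ffun=> p.1] p.2.
have e_inj : injective e.
  move=> [c s] [c' s'] [] /ffunP/(_ ord0); rewrite !ffunE => /= -> ss'.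
  by congr pair.
have prod_e p : \prod_i wcol (e p) i = p.1 ^+ n.+1.
  case: p => c s; rewrite (eq_bigr (fun=> c)); last by move=> i _; rewrite ffunE.
  by rewrite (prodg_const 'I_n.+1) card_ord.
pose t (s : 'S_n.+1) := s^-1 * wperm g.
have t_inj : injective t by move=> s s' /mulIg/invg_inj.
rewrite -(card_full_cycle n) -(card_preimset _ t_inj) -cardsX.
rewrite -(card_imset _ e_inj) diag_symE -/e; apply: eq_card => h; rewrite inE.
apply/andP/imsetP=> [[/imsetP[p _ ->]] | [p Ip ->]].
  rewrite mem_color_classU wreath_prodM wreath_prodV prod_e => /andP[p_full Ip].
  by exists p => //; rewrite !inE Ip.
move: Ip; rewrite mem_color_classU wreath_prodM wreath_prodV prod_e !inE.
by case/andP=> -> ->; rewrite imset_f ?inE.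
Qed.

End CyclicColors.

(** * Factorizations of a finite group *)

(** The second factor is determined by the first one. *)
Lemma card_factorizations (gT : finGroupType) (A B : {set gT}) (g : gT) :
  #|[set p in setX A B | p.1 * p.2 == g]| = #|[set a in A | a^-1 * g \in B]|.
Proof.
pose e a : gT * gT := (a, a^-1 * g).
have e_inj : injective e by move=> a a' [].
rewrite -[RHS](card_imset _ e_inj); apply: eq_card => -[a b].
rewrite !inE /=; apply/andP/imsetP=> [[/andP[Aa Bb] /eqP abg] | [a']].
  by exists a; rewrite ?inE /e -abg mulKg ?Aa.
by rewrite inE => /andP[Aa Bb] [-> ->]; rewrite Aa Bb mulKVg.
Qed.

(** Conjugating by [u^-1] moves the left factor from a conjugate of A to A itself;
the right factor stays in B because B is closed under conjugation. *)
Lemma card_factorizationsJ (gT : finGroupType) (A B : {set gT}) (g u : gT) :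
    (forall x v, x \in B -> x ^ v \in B) ->
  #|[set a in A :^ u | a^-1 * g \in B]|
    = #|[set a in A | a^-1 * g ^ u^-1 \in B]|.
Proof.
move=> BJ; rewrite -[RHS](card_imset _ (conjg_inj u)).
apply: eq_card => x; rewrite inE.
apply/andP/imsetP=> [[/imsetP[a Aa ->] Bx] | [a]].
  exists a => //; rewrite inE Aa -[a in a^-1](conjgK u) -conjVg -conjMg.
  exact: BJ.
rewrite inE => /andP[Aa Ba] ->; split; first by rewrite memJ_conjg.
by rewrite -(conjgKV u g) -conjVg -conjMg BJ.
Qed.

Theorem theorem5p1 (m n d t : nat) (cT : finGroupType) (w : cT)
    (n_gt0 : (0 < n)%N)
    (w_gen : [set: cT] = <[w]>) (w_ord : #[w] = m)
    (d_def : gcdn m n = d) (m_def : m = (d * t)%N)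
    (H : {group wreath cT n})
    (H_conj : exists g : wreath cT n, H :=: diag_sym n w :^ g)
    (l : nat) (l_bounds : (1 <= l <= t)%N)
    (I : {set cT}) (I_card : #|I| = (d * l)%N)
    (I_cosets : forall D : {set cT},
       D \in lcosets <[w ^+ d]> [set: cT] -> #|I :&: D| = l) :
  rfold_factorization (d * l * (n.-1)`!)%N
    H (\bigcup_(i in I) color_class n i).
Proof.
case: n => [//|n] in n_gt0 d_def H H_conj *.
have [u ->] := H_conj; move=> g; rewrite card_factorizations.
rewrite card_factorizationsJ; last first.
  by move=> x v; exact: (color_classU_conj w_gen).
rewrite (card_diag_sym_translate w_gen) (card_expg_translate w_gen).
rewrite cycle_gcd w_ord d_def I_cosets //.
by rewrite mem_lcosets (subsetP (mulG_subl _ _)) ?inE.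
Qed.
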